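(* Let $(V,E)$ be a Cayley tree, and let $\mu$ be a tree-indexed Markov chain on $\{-1,0,1\}^V$ which is invariant under tree automorphisms and whose transition matrix $P$ has strictly positive matrix elements. For $t\ge 0$ let $\mu_t$ be the time-evolved measure with starting measure $\mu$ under the spin-flip dynamics, and let $B_t$ be the set of bad configurations for $\mu_t$. Then for each time $t$, $\mu_t(B_t)\in\{0,1\}$.
   Context: The Cayley tree of order $d$ is the infinite tree $(V,E)$ in which each vertex has exactly $d+1$ neighbours. $\Omega=\{-1,0,1\}^V$ carries the product $\sigma$-algebra; $\sigma_\Lambda$ denotes the restriction map $\omega\mapsto\omega_\Lambda$, $\mathcal F_\Lambda$ the $\sigma$-algebra generated by $\sigma_\Lambda$, and $\Lambda\Subset V$ means $\Lambda$ is a finite subset. A function is local if it is $\mathcal F_\Lambda$-measurable for some $\Lambda\Subset V$. A probability measure $\mu$ on $\Omega$ is a tree-indexed Markov chain if for each oriented edge $ij$ one has $\mu(\sigma_j=x\mid\mathcal F_{(-\infty,ij)})=\mu(\sigma_j=x\mid\mathcal F_{\{i\}})$ $\mu$-a.s. for all $x$, where $(-\infty,ij)$ is the set of vertices $k$ whose self-avoiding path to $i$ does not contain $j$. For an automorphism-invariant $\mu$, the transition matrix is $P(x,y)=\mu(\sigma_j=y\mid\sigma_i=x)$, which does not depend on the oriented edge $ij$. Spin-flip dynamics: for $t\ge0$, $\mu_t$ is the image of $\mu$ under the product kernel that acts independently at each site by $$p_t(\omega,\eta)=\tfrac12(1+e^{-2t})1_{\{\omega=\eta\ne0\}}+\tfrac12(1-e^{-2t})1_{\{\omega\eta=-1\}}+1_{\{\omega=\eta=0\}},\qquad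 \omega,\eta\in\{-1,0,1\}.$$ Bad configurations: $\eta\in\Omega$ is bad for $\mu_t$ if there exist a local function $f$ and $\Lambda_0\Subset V$ such that $$\limsup_{\Lambda\nearrow V}\ \sup_{\xi^1,\xi^2\in\Omega,\ \Delta:\Lambda\subset\Delta\Subset V}\big|\mu_t(f\mid\eta_{\Lambda\setminus\Lambda_0}\xi^1_{\Delta\setminus\Lambda})-\mu_t(f\mid\eta_{\Lambda\setminus\Lambda_0}\xi^2_{\Delta\setminus\Lambda})\big|>0,$$ where $\mu_t(f\mid\zeta_A)$ is the elementary conditional expectation of $f$ given $\{\sigma_A=\zeta_A\}$ and the limsup is along finite $\Lambda$ directed by inclusion. *)

(* Defs.v *)
From HB Require Import structures.
From mathcomp Require Import all_boot all_order all_algebra finmap.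
From mathcomp Require Import all_classical all_reals all_analysis.

Set Implicit Arguments.
Unset Strict Implicit.
Unset Printing Implicit Defensive.

Import Order.TTheory GRing.Theory Num.Theory.
Import numFieldNormedType.Exports.

Local Open Scope classical_set_scope.
Local Open Scope ring_scope.

Record is_cayley_tree (V : choiceType) (d : nat) (e : rel V) : Prop := {
  tree_sym : symmetric e;
  tree_irr : irreflexive e;
  tree_connected : forall i j, exists2 p, path e i p & last i p = j;
  tree_acyclic : forall c, ucycle e c -> (size c <= 2)%N;
  tree_degree : forall i, ([set j | e i j] #= `I_d.+1)%card;
  tree_infinite : infinite_set [set: V] }.

Definition is_automorphism (V : choiceType) (e : rel V) (phi : V -> V) : Prop :=
  bijective phi /\ forall i j, e (phi i) (phi j) = e i j.

(* The set (-oo, ij). Self-avoiding paths in a tree are unique, so the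
   existential path is the path from k to i. *)
Definition past (V : choiceType) (e : rel V) (i j : V) : set V :=
  [set k | exists p, [/\ path e k p, last k p = i, uniq (k :: p)
                       & j \notin k :: p]].

Definition spin : Type := seq_sub [:: -1; 0; 1 : int].
HB.instance Definition _ := Finite.on spin.
HB.instance Definition _ :=
  isPointed.Build spin (@SeqSub _ [:: -1; 0; 1 : int] 0 isT).

(* Events {sigma_i = x} with i in L; they generate F_L, as spin is finite. *)
Definition coord_events (V : choiceType) (L : set V) : set (set (V -> spin)) :=
  [set [set w | w i = x] | i in L & x in [set: spin]].

Definition Omega (V : choiceType) : Type :=
  g_sigma_algebraType (@coord_events V [set: V]).

Definition F_ (V : choiceType) (L : set V) : set (set (Omega V)) :=
  <<s coord_events L >>.

Definition F_measurable (V : choiceType) (R : realType) (L : set V)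
    (f : Omega V -> R) : Prop :=
  measurable_fun [set: g_sigma_algebraType (coord_events L)] f.

Definition is_local (V : choiceType) (R : realType) (f : Omega V -> R) : Prop :=
  exists L : {fset V}, F_measurable [set` L] f.

Definition spin_at (V : choiceType) (i : V) (x : spin) : set (Omega V) :=
  [set w | w i = x].

Definition cylinder (V : choiceType) (A : {fset V}) (z : V -> spin) :
    set (Omega V) :=
  [set w | forall i, i \in A -> w i = z i].

(* g is a version of mu(A | F_L) *)
Definition is_cond_prob (V : choiceType) (R : realType)
    (mu : probability (Omega V) R) (L : set V) (A : set (Omega V))
    (g : Omega V -> R) : Prop :=
  [/\ F_measurable L g, mu.-integrable setT (EFin \o g)
    & forall B, F_ L B -> (\int[mu]_(w in B) (g w)%:E = mu (A `&` B))%E].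

Definition is_tree_markov_chain (V : choiceType) (R : realType) (e : rel V)
    (mu : probability (Omega V) R) : Prop :=
  forall i j, e i j -> forall x, exists g h : Omega V -> R,
    [/\ is_cond_prob mu (past e i j) (spin_at j x) g,
        is_cond_prob mu [set i] (spin_at j x) h
      & {ae mu, forall w, g w = h w}].

Definition is_automorphism_invariant (V : choiceType) (R : realType)
    (e : rel V) (mu : probability (Omega V) R) : Prop :=
  forall phi, is_automorphism e phi -> forall B : set (Omega V), measurable B ->
    pushforward mu (fun w : Omega V => (w \o phi : Omega V)) B = mu B.

Definition is_transition_matrix (V : choiceType) (R : realType) (e : rel V)
    (mu : probability (Omega V) R) (P : spin -> spin -> R) : Prop :=
  forall i j, e i j -> forall x y,
    P x y = fine (mu (spin_at j y `&` spin_at i x)) / fine (mu (spin_at i x)).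

Definition flip_prob (R : realType) (t : R) (w z : spin) : R :=
  2^-1 * (1 + expR (- (2 * t))) * ((w == z) && (val z != 0))%:R
  + 2^-1 * (1 - expR (- (2 * t))) * (val w * val z == -1)%:R
  + ((w == z) && (val z == 0))%:R.

(* A probability on Omega is determined by its values on cylinders, so this
   says that K w is the product over i in V of flip_prob t (w i). *)
Definition is_spin_flip_kernel (V : choiceType) (R : realType) (t : R)
    (K : R.-pker Omega V ~> Omega V) : Prop :=
  forall (w : Omega V) (A : {fset V}) (z : Omega V),
    K w (cylinder A z) = (\prod_(i <- A) flip_prob t (w i) (z i))%:E.

Definition is_time_evolved (V : choiceType) (R : realType) (t : R)
    (mu mut : probability (Omega V) R) : Prop :=
  exists2 K : R.-pker Omega V ~> Omega V, is_spin_flip_kernel t K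
    & forall B, measurable B -> (mut B = \int[mu]_w K w B)%E.

(* Junk value 0 when the conditioning cylinder is null *)
Definition cond_expectation (V : choiceType) (R : realType)
    (nu : probability (Omega V) R) (f : Omega V -> R) (A : {fset V})
    (z : V -> spin) : R :=
  (\int[nu]_(w in cylinder A z) f w) / fine (nu (cylinder A z)).

Definition splice (V : choiceType) (L : {fset V}) (eta xi : Omega V) : Omega V :=
  fun i => if i \in L then eta i else xi i.

Definition oscillation (V : choiceType) (R : realType)
    (nu : probability (Omega V) R) (f : Omega V -> R) (eta : Omega V)
    (L0 L : {fset V}) : \bar R :=
  ereal_sup [set r | exists (xi1 xi2 : Omega V) (D : {fset V}), (L `<=` D)%fset /\
    let A := ((L `\` L0) `|` (D `\` L))%fset in
    r = `| cond_expectation nu f A (splice L eta xi1)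
         - cond_expectation nu f A (splice L eta xi2) |%:E].

(* limsup along the finite subsets of V, directed by inclusion *)
Definition fset_limsup (V : choiceType) (R : realType)
    (u : {fset V} -> \bar R) : \bar R :=
  ereal_inf [set ereal_sup [set u L | L in [set L | (M `<=` L)%fset]]
            | M in [set: {fset V}]].

Definition bad_configurations (V : choiceType) (R : realType)
    (nu : probability (Omega V) R) : set (Omega V) :=
  [set eta | exists (f : Omega V -> R) (L0 : {fset V}),
    is_local f /\ (0 < fset_limsup (oscillation nu f eta L0))%E].

(* Main.v *)
Require Import Defs.
From HB Require Import structures.
From mathcomp Require Import all_boot all_order all_algebra finmap.
From mathcomp Require Import all_classical all_reals all_analysis.
From mathcomp Require Import measurable_realfun lra.
Import Order.TTheory GRing.Theory Num.Theory.
Import numFieldNormedType.Exports.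
Local Open Scope classical_set_scope.
Local Open Scope ring_scope.

(* A bad configuration can be witnessed by the indicator of a cylinder and by
   an oscillation threshold 1/k, so the bad set is measurable; it is preserved by
   every tree automorphism, because [mut] is.  Automorphisms act transitively on
   the vertices, so a finite set can be moved arbitrarily far away.  Conditionally
   on the spin at a vertex r, the spins behind r are independent of those in front
   of it, and a long path leading to r forgets its initial spin exponentially fast
   since P is strictly positive.  Hence the translates of a cylinder become
   asymptotically independent of any other cylinder, first under [mu], then under
   [mut] since the flips act independently at different sites.  This mixing
   property extends to all measurable sets, and gives [mut B = mut B ^ 2] for an
   invariant set B. *)

Set Implicit Arguments.
Unset Strict Implicit.
Unset Printing Implicit Defensive.

(** * Rooted trees *)

(** A tree seen from the root [o] through a parent map and a depth. The convention [par o = o] makes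
    all iterates of [par] available, and [edge_cases] says that every edge joins a vertex to its
    parent. *)
Record rooting (V : choiceType) (e : rel V) (o : V) (par : V -> V)
    (dep : V -> nat) : Prop := {
  dep_root : dep o = 0%N;
  par_root : par o = o;
  dep_par : forall x, x != o -> dep x = (dep (par x)).+1;
  edge_par : forall x, x != o -> e x (par x);
  edge_cases : forall x y, e x y -> x != o /\ y = par x \/ y != o /\ x = par y }.

(** The subtree behind [r], with [r] itself included. *)
Definition descendants (V : choiceType) (par : V -> V) (r : V) : set V :=
  [set k | exists n, iter n par k = r].

(** Connectedness in the tree with [j] removed. Walks may repeat vertices, which makes symmetry and
    transitivity easy; [linked_uniq] recovers the self-avoiding paths that [past] asks for. *)
Definition linked (V : choiceType) (e : rel V) (j x y : V) : Prop :=
  exists p, [/\ path e x p, last x p = y & j \notin x :: p].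

(** * Connectivity after removal of a vertex *)

Section Linked.
Context (V : choiceType) (e : rel V).
Hypothesis e_sym : symmetric e.

Lemma linked_refl j x : x != j -> linked e j x x.
Proof. by move=> xj; exists [::]; split=> //; rewrite inE eq_sym. Qed.

Lemma linked_step j x y z : x != j -> e x y -> linked e j y z -> linked e j x z.
Proof.
move=> xj exy [p [pp lp jp]]; exists (y :: p); split=> //=; first by rewrite exy.
by rewrite inE negb_or eq_sym xj.
Qed.

Lemma linked_sym j x y : linked e j x y -> linked e j y x.
Proof.
move=> [p [pp lp jp]]; exists (rev (belast x p)); split.
- rewrite -lp rev_path (eq_path (e' := e)) // => u v; exact: e_sym.
- by case: p {pp jp} lp => [|z p] //= ; rewrite rev_cons last_rcons.
- by rewrite -lp -rev_rcons -lastI mem_rev.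
Qed.

Lemma linked_trans j x y z : linked e j x y -> linked e j y z -> linked e j x z.
Proof.
move=> [p [pp lp jp]] [q [pq lq jq]]; exists (p ++ q); split.
- by rewrite cat_path pp lp.
- by rewrite last_cat lp.
- rewrite -cat_cons mem_cat negb_or jp; move: jq.
  by rewrite inE negb_or => /andP[].
Qed.

Lemma linked_uniq j x y : linked e j x y ->
  exists p, [/\ path e x p, last x p = y, uniq (x :: p) & j \notin x :: p].
Proof.
move=> [p [pp lp jp]]; move: lp; case/shortenP: pp => q pq uq qp lq.
exists q; split=> //; apply: contra jp; rewrite !inE => /orP[->//|/qp ->].
by rewrite orbT.
Qed.

Lemma past_linked i j k : linked e j k i -> past e i j k.
Proof. by move=> /linked_uniq[p [? ? ? ?]]; exists p; split. Qed.

End Linked.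

(** * Distance to a root and existence of rootings *)

Section Tree.
Context (V : choiceType) (d : nat) (e : rel V).
Hypothesis tree : is_cayley_tree d e.

Let e_sym : symmetric e := tree_sym tree.

(** A nontrivial self-avoiding path from [x] to [y] off [j] would close up through [j] to a cycle of
    length at least 3. *)
Lemma neighbours_not_linked j x y :
  e j x -> e j y -> linked e j x y -> x = y.
Proof.
move=> ejx ejy /linked_uniq[p [pp lp up jp]].
case: p pp lp up jp => [//|z p] pp lp up jp.
have : ucycle e [:: j, x, z & p].
  rewrite /ucycle; apply/andP; split; last by rewrite cons_uniq jp.
  have -> : cycle e [:: j, x, z & p] = e j x && path e x (rcons (z :: p) j) by [].
  by rewrite rcons_path pp lp ejx e_sym.
by move=> /(tree_acyclic tree).
Qed.

Definition walk (o x : V) (n : nat) : Prop :=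
  exists p, [/\ path e o p, last o p = x & size p = n].

Lemma ex_walk o x : exists n, `[< walk o x n >].
Proof.
have [p pp lp] := tree_connected tree o x.
by exists (size p); apply/asboolP; exists p.
Qed.

Definition distance (o x : V) : nat := ex_minn (ex_walk o x).

Lemma distanceP o x : walk o x (distance o x).
Proof. by rewrite /distance; case: ex_minnP => n /asboolP. Qed.

Lemma distance_min o x n : walk o x n -> (distance o x <= n)%N.
Proof. by rewrite /distance; case: ex_minnP => m _ H /asboolP/H. Qed.

Lemma distance0 o : distance o o = 0%N.
Proof. by apply/eqP; rewrite -leqn0; apply: distance_min; exists [::]. Qed.

Lemma distance_edge o x y : e x y -> (distance o y <= (distance o x).+1)%N.
Proof.
move=> exy; have [p [pp lp <-]] := distanceP o x.
apply: distance_min; exists (rcons p y); split.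
- by rewrite rcons_path pp lp.
- by rewrite last_rcons.
- by rewrite size_rcons.
Qed.

Lemma ex_predecessor o x : x != o ->
  exists2 y, e x y & distance o x = (distance o y).+1.
Proof.
have [p] := distanceP o x; case/lastP: p => [|p z] [pp lp sp] xo.
  by move: xo; rewrite -lp eqxx.
move: lp pp sp; rewrite last_rcons rcons_path size_rcons => -> /andP[pp ez] sp.
exists (last o p); first by rewrite e_sym.
apply/eqP; rewrite eqn_leq distance_edge // -sp ltnS.
by apply: distance_min; exists p.
Qed.

(** A shortest walk from [x] to [o] gets closer at each step, so after [x] it stays strictly closer
    to [o] than [j] and cannot meet [j]. *)
Lemma linked_root o j x : x != j -> (distance o x <= distance o j)%N ->
  linked e j x o.
Proof.
move En: (distance o x) => n; elim: n x En => [|n IH] x En xj nj.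
  have [xo|/ex_predecessor[y _]] := eqVneq x o; last by rewrite En.
  by rewrite -xo; apply: linked_refl.
have [xo|/ex_predecessor[y exy]] := eqVneq x o.
  by move: En; rewrite xo distance0.
rewrite En => -[ny]; apply: linked_step exy _ => //; apply: IH => //.
- by apply: contraTneq nj => <-; rewrite -ny ltnn.
- exact: ltnW.
Qed.

(** The depth is the distance to [o], and the parent is a chosen neighbour one step closer. It is
    the only neighbour of [x] not farther than [x]: two such neighbours would be linked through [o]
    in the complement of [x]. *)
Lemma ex_rooting o : exists par dep, rooting e o par dep.
Proof.
have H x : exists y, (x != o -> e x y /\ distance o x = (distance o y).+1) /\
    (x = o -> y = o).
  have [->|xo] := eqVneq x o; first by exists o.
  have [y exy dy] := ex_predecessor xo; exists y; split=> // E.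
  by rewrite E eqxx in xo.
have [par Hpar] := choice H; exists par, (distance o); split.
- exact: distance0.
- by have [_] := Hpar o; apply.
- by move=> x xo; have [/(_ xo)[]] := Hpar x.
- by move=> x xo; have [/(_ xo)[]] := Hpar x.
suff main x y : e x y -> (distance o y <= distance o x)%N -> x != o /\ y = par x.
  move=> x y exy; case/orP: (leq_total (distance o y) (distance o x)) => H'.
    by left; apply: main.
  by right; apply: main => //; rewrite e_sym.
move=> exy le_yx; have yx : y != x.
  by apply: contraTneq exy => ->; rewrite (tree_irr tree).
have xo : x != o.
  apply: contraTneq le_yx => xo; rewrite xo distance0 -ltnNge.
  have [yo|/ex_predecessor[z _ ->//]] := eqVneq y o.
  by rewrite xo yo eqxx in yx.
split=> //; have [/(_ xo)[ep dp] _] := Hpar x.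
have px : par x != x by apply: contraTneq ep => ->; rewrite (tree_irr tree).
apply: (neighbours_not_linked exy ep).
apply: linked_trans (linked_root yx le_yx) _; apply: (linked_sym e_sym).
by apply: (linked_root px); rewrite dp leqnSn.
Qed.

End Tree.

(** * Descendants, levels and children in a rooted tree *)

Section Rooting.
Context (V : choiceType) (d : nat) (e : rel V).
Hypothesis tree : is_cayley_tree d e.
Context (o : V) (par : V -> V) (dep : V -> nat).
Hypothesis rt : rooting e o par dep.

Lemma dep_eq0 x : dep x = 0%N -> x = o.
Proof. by have [//|/(dep_par rt)->] := eqVneq x o. Qed.

Lemma rooting_ind (Q : V -> Prop) :
  Q o -> (forall x, x != o -> Q (par x) -> Q x) -> forall x, Q x.
Proof.
move=> Q0 QS x; move En: (dep x) => n; elim: n x En => [|n IH] x En.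
  by rewrite (dep_eq0 En).
have [->//|xo] := eqVneq x o; apply: QS => //; apply: IH.
by have := dep_par rt xo; rewrite En => -[].
Qed.

Lemma descendants_refl r : descendants par r r.
Proof. by exists 0%N. Qed.

Lemma descendants_par r x : descendants par r (par x) -> descendants par r x.
Proof. by move=> [n h]; exists n.+1; rewrite iterSr. Qed.

Lemma descendants_inv r x : descendants par r x -> x = r \/ descendants par r (par x).
Proof. by move=> [[|n] h]; [left|right; exists n; rewrite -iterSr]. Qed.

Lemma descendants_trans r s x :
  descendants par r s -> descendants par s x -> descendants par r x.
Proof. by move=> [n hn] [m hm]; exists (n + m)%N; rewrite iterD hm. Qed.

Lemma descendants_dep r x : descendants par r x -> (dep r <= dep x)%N.
Proof.
move=> [n]; elim: n x => [|n IH] x; first by move=> /= ->.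
rewrite iterSr => /IH h; have [xo|xo] := eqVneq x o.
  by move: h; rewrite xo (par_root rt).
by rewrite (dep_par rt xo) (leq_trans h).
Qed.

Lemma descendants_dep_eq r x : descendants par r x -> (dep x <= dep r)%N -> x = r.
Proof.
have [->|xo] := eqVneq x o.
  by move=> /descendants_dep; rewrite (dep_root rt) leqn0 => /eqP/dep_eq0 ->.
move=> /descendants_inv[//|/descendants_dep].
by rewrite (dep_par rt xo) => h h'; have := leq_trans h' h; rewrite ltnn.
Qed.

(** Outside the subtree of [j], following parents leads to [o] without meeting [j]; the walks from
    [k] and from [par j] are joined at [o]. *)
Lemma past_par j k : j != o -> ~ descendants par j k -> past e (par j) j k.
Proof.
move=> jo njk; apply: past_linked.
have to_root x : ~ descendants par j x -> linked e j x o.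
  elim/rooting_ind: x => [|x xo IH] njx.
    by apply: linked_refl; rewrite eq_sym.
  apply: (@linked_step _ _ _ _ (par x)).
  - by apply: contra_notN njx => /eqP->; apply: descendants_refl.
  - exact: edge_par rt _ xo.
  - by apply: IH => h; apply: njx; apply: descendants_par.
apply: linked_trans (to_root _ njk) (linked_sym (tree_sym tree) (to_root _ _)).
by move=> /descendants_dep; rewrite (dep_par rt jo) ltnn.
Qed.

(** Going down an edge stays inside a subtree; going up leaves it by at most one generation. *)
Lemma descendants_edge n r x y : e x y -> descendants par (iter n par r) x ->
  descendants par (iter n.+1 par r) y.
Proof.
move=> /(edge_cases rt)[[_ ->] h|[_ ->] h].
  apply: (@descendants_trans _ (par (iter n par r))); first exact: descendants_refl.
  by move: h => [m h]; exists m; rewrite -iterSr iterS h.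
apply: (@descendants_trans _ (iter n par r)); first by exists 1%N.
exact: descendants_par.
Qed.

Lemma finite_neighbours x : finite_set [set y | e x y].
Proof. by exists d.+1; exact: (tree_degree tree). Qed.

Lemma finite_level n : finite_set [set x | dep x = n].
Proof.
elim: n => [|n IH].
  by apply: (@sub_finite_set _ _ [set o]) => // x /= /dep_eq0 ->.
apply: (@sub_finite_set _ _ (\bigcup_(x in [set x | dep x = n]) [set y | e x y])).
  move=> y /= hy; have [yo|yo] := eqVneq y o.
    by move: hy; rewrite yo (dep_root rt).
  exists (par y) => /=; first by have := dep_par rt yo; rewrite hy => -[].
  by rewrite (tree_sym tree) (edge_par rt).
by apply: bigcup_finite => // x _; exact: finite_neighbours.
Qed.

Lemma vertices_countable : countable [set: V].
Proof.
have -> : [set: V] = \bigcup_n [set x | dep x = n].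
  by apply/seteqP; split=> // x _; exists (dep x).
by apply: bigcup_countable => // n _; apply: finite_set_countable; exact: finite_level.
Qed.

Lemma ex_dep n : exists x, dep x = n.
Proof.
(* Climbing from a deep vertex meets every smaller depth; deep vertices exist because levels are
   finite and the tree is not. *)
suff [x] : exists x, (n <= dep x)%N.
  elim/rooting_ind: x => [|x xo IH].
    by rewrite (dep_root rt) leqn0 => /eqP ->; exists o; exact: dep_root rt.
  by rewrite leq_eqVlt => /orP[/eqP->|]; [exists x|rewrite (dep_par rt xo)].
apply: contrapT => /forallNP h; apply: (tree_infinite tree).
have -> : [set: V] = \bigcup_(k in `I_n) [set x | dep x = k].
  apply/seteqP; split=> // x _; exists (dep x) => //=.
  by rewrite ltnNge; apply/negP.
by apply: bigcup_finite => // k _; exact: finite_level.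
Qed.

Lemma iter_par_dep n r : (n <= dep r)%N -> dep (iter n par r) = (dep r - n)%N.
Proof.
elim: n => [|n IH] h; first by rewrite subn0.
have hn := ltnW h; rewrite iterS subnS -(IH hn).
have [E|ne] := eqVneq (iter n par r) o; last by rewrite (dep_par rt ne).
by move: (IH hn); rewrite E (dep_root rt) => /esym/eqP; rewrite subn_eq0 leqNgt h.
Qed.

Definition children x : set V := [set y | y != o /\ par y = x].

Lemma finite_children x : finite_set (children x).
Proof.
apply: sub_finite_set (finite_neighbours x) => y [yo <-] /=.
by rewrite (tree_sym tree) (edge_par rt).
Qed.

Lemma card_children x :
  #|` fset_set (children x)| = if x == o then d.+1 else d.
Proof.
have cN : #|` fset_set [set y | e x y]| = d.+1.
  by apply: card_fset_set; exact: (tree_degree tree).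
case: ifP => [/eqP xo|/negbT xo].
  suff -> : children x = [set y | e x y] by [].
  apply/seteqP; split=> y /=.
    by case=> yo <-; rewrite (tree_sym tree) (edge_par rt).
  by move=> /(edge_cases rt)[[]|[yo h]]; [rewrite xo eqxx|split].
have -> : children x = [set y | e x y] `\ par x.
  apply/seteqP; split=> y /=.
    case=> yo yx; split; first by rewrite -yx (tree_sym tree) (edge_par rt).
    move=> yx'; have := dep_par rt yo; rewrite yx yx' (dep_par rt xo) => /eqP.
    by rewrite -[X in X == _]addn0 -addn2 eqn_add2l.
  by case=> /(edge_cases rt)[[_ ->]|[yo h]] ne //; split.
rewrite fset_setD1; last exact: finite_neighbours.
have px : par x \in fset_set [set y | e x y].
  by rewrite in_fset_set ?inE /= ?(edge_par rt) //; exact: finite_neighbours.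
by move: cN; rewrite (cardfsD1 (par x)) px => -[].
Qed.

End Rooting.

Lemma card_fset_set_bij (V : choiceType) (A B : set V) :
  finite_set A -> finite_set B -> #|` fset_set A| = #|` fset_set B| ->
  exists f : V -> V, set_bij A B f.
Proof.
move=> fA fB /(fcard_eq fA fB) AB.
have [B0|/set0P[b _]] := eqVneq B set0; last first.
  (* Turning equipotence into a bijection requires a pointed codomain; [b] is the base point. *)
  pose U : pointedType := HB.pack V (isPointed.Build V b).
  exact: (@card_set_bijP V U A B AB).
move: AB; rewrite B0 card_eq0 => /eqP ->; exists id.
by split.
Qed.

(** * Transitivity of the automorphism group on vertices *)

Section Transitivity.
Context (V : choiceType) (d : nat) (e : rel V).
Hypothesis tree : is_cayley_tree d e.

(* Starting from u, the children of x are matched with those of its image. *)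
Lemma automorphism_transitive u v :
  exists2 phi, is_automorphism e phi & phi u = v.
Proof.
have [paru [depu ru]] := ex_rooting tree u.
have [parv [depv rv]] := ex_rooting tree v.
(* The pair stands for a vertex and its prospective image. If both or neither are roots, they have
   equally many children; otherwise any function will do. *)
have exb (ab : V * V) : exists f, (ab.1 == u) = (ab.2 == v) ->
    set_bij (children u paru ab.1) (children v parv ab.2) f.
  have [h|h] := eqVneq (ab.1 == u) (ab.2 == v); last by exists id => h'; rewrite h' eqxx in h.
  have [f hf] : exists f, set_bij (children u paru ab.1) (children v parv ab.2) f.
    apply: card_fset_set_bij.
    - exact: (finite_children tree ru).
    - exact: (finite_children tree rv).
    - by rewrite (card_children tree ru) (card_children tree rv) h.
  by exists f.
have [b hb] := choice exb.
(* The recursion is on the depth: [F (depu x) x] climbs from [x] to [u], whose image is [v]. *)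
pose fix F n x {struct n} := if n is n'.+1 then b (paru x, F n' (paru x)) x else v.
pose phi x := F (depu x) x.
have phiu : phi u = v by rewrite /phi (dep_root ru).
have phiS x : x != u -> phi x = b (paru x, phi (paru x)) x.
  by move=> xu; rewrite /phi (dep_par ru xu).
have root_phi x : (x == u) = (phi x == v).
  elim/(rooting_ind ru): x => [|x xu IH]; first by rewrite phiu !eqxx.
  rewrite (negbTE xu) phiS //; have [/(_ x)[]//=] := hb (_, _) IH.
  by move=> h _ _ _; apply/esym/negbTE.
have bij x : set_bij (children u paru x) (children v parv (phi x)) (b (x, phi x)).
  exact: (hb (_, _) (root_phi x)).
have phi_par x : x != u -> parv (phi x) = phi (paru x).
  move=> xu; rewrite (phiS _ xu); have [h _ _] := bij (paru x).
  by have [] : children v parv (phi (paru x)) (b (paru x, phi (paru x)) x) by apply: h.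
(* Equal images have equal parents, so by induction the vertices share a parent, and [b] is
   injective on its children. *)
have phi_inj : injective phi.
  elim/(rooting_ind ru) => [|x xu IH] y.
    by rewrite phiu => /esym/eqP; rewrite -root_phi => /eqP.
  move=> E; have yu : y != u by rewrite root_phi -E -root_phi.
  have pE : paru x = paru y by apply: IH; rewrite -!phi_par // E.
  have [_ inj _] := bij (paru x); apply: inj; rewrite ?inE //.
  by rewrite -phiS // E phiS // pE.
have phi_surj y : exists x, phi x = y.
  elim/(rooting_ind rv): y => [|y yv [a ha]]; first by exists u.
  have [_ _ sur] := bij a; have [x [xu xa] <-] := sur y (conj yv (esym ha)).
  by exists x; rewrite phiS // xa.
have [psi hpsi] := choice phi_surj.
exists phi => //; split.
  by exists psi => // x; apply: phi_inj; rewrite hpsi.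
(* A rooting determines the edges, so it is enough that [phi] commutes with the parent maps. *)
have edge_iff (o : V) par dep (r : rooting e o par dep) i j :
    e i j <-> (i != o /\ j = par i) \/ (j != o /\ i = par j).
  split; first exact: edge_cases r _ _.
  by case=> -[ne ->]; [|rewrite (tree_sym tree)]; exact: (edge_par r).
move=> x y; apply/idP/idP.
  move=> /(edge_iff _ _ _ rv) h; apply/(edge_iff _ _ _ ru); move: h.
  by case=> -[]; rewrite -root_phi => ne; rewrite phi_par // => /phi_inj; [left|right].
move=> /(edge_iff _ _ _ ru) h; apply/(edge_iff _ _ _ rv); move: h.
by case=> -[ne ->]; [left|right]; rewrite -root_phi phi_par.
Qed.

End Transitivity.

(** * Finite-dimensional events and functions *)

Definition agree (V : choiceType) (L : set V) (w w' : Omega V) : Prop :=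
  forall i, L i -> w i = w' i.

Definition restrict (V : choiceType) (A : {fset V}) (w : Omega V) :
  {ffun A -> spin} := [ffun a : A => w (val a)].

(** A representative of the pattern [x], equal to the default spin 0 outside [A]. It lets finite
    sums run over the finite type of patterns. *)
Definition extend (V : choiceType) (A : {fset V}) (x : {ffun A -> spin}) :
  Omega V := fun i => if insub i is Some a then x a else point.

Section FiniteDimensional.
Context (V : choiceType).

(** The sets insensitive to changes outside [L] form a sigma-algebra that contains the
    generators. *)
Lemma F_agree (L : set V) B : F_ L B ->
  forall w w', agree L w w' -> B w -> B w'.
Proof.
move=> FB; have H : F_ L `<=` [set B | forall w w', agree L w w' -> B w <-> B w'].
  apply: smallest_sub.
    split=> //.
    - by move=> A hA w w' /hA h; rewrite setTD /=; split=> h1 h2; apply: h1; apply/h.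
    - by move=> F hF w w' ww'; split=> -[n _ Fn]; exists n => //; apply/(hF n _ _ ww').
  by move=> _ [i Li [x _ <-]] w w' /(_ i Li) /= ->.
by move=> w w' /(H _ FB)[].
Qed.

Lemma sub_F (L L' : set V) : L `<=` L' -> F_ L `<=` F_ L'.
Proof.
move=> LL'; apply: sub_sigma_algebra2 => _ [i Li [x _ <-]].
by exists i; [exact: LL'|exists x].
Qed.

Lemma F_measurableE (L : set V) (B : set (Omega V)) : F_ L B -> measurable B.
Proof. exact: (@sub_F L setT). Qed.

Lemma F_spin_at (L : set V) i x : L i -> F_ L (spin_at i x).
Proof. by move=> Li; apply: sub_sigma_algebra; exists i => //; exists x. Qed.

Lemma F_setT (L : set V) : F_ L setT.
Proof. exact: (@measurableT _ (g_sigma_algebraType (coord_events L))). Qed.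

Lemma F_setI (L : set V) B C : F_ L B -> F_ L C -> F_ L (B `&` C).
Proof. exact: (@measurableI _ (g_sigma_algebraType (coord_events L))). Qed.

Lemma F_cylinder (L : set V) (A : {fset V}) z :
  [set` A] `<=` L -> F_ L (cylinder A z).
Proof.
move=> AL; have -> : cylinder A z = \bigcap_(i in [set` A]) spin_at i (z i).
  by [].
apply: (@fin_bigcap_measurable _ (g_sigma_algebraType (coord_events L))) => //.
by move=> i Ai; apply: F_spin_at; apply: AL.
Qed.

Lemma measurable_cylinder (A : {fset V}) z : measurable (cylinder A z).
Proof. exact: (@F_cylinder setT). Qed.

Lemma measurable_spin_at (i : V) x : measurable (spin_at i x).
Proof. exact: (@F_spin_at setT). Qed.

Lemma cylinder_agree (A : {fset V}) z z' :
  agree [set` A] z z' -> cylinder A z = cylinder A z'.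
Proof.
move=> zz'; apply/seteqP; split=> w h i iA; rewrite h //.
  exact: zz'.
exact/esym/zz'.
Qed.

Lemma cylinder0 z : cylinder (fset0 : {fset V}) z = setT.
Proof. by apply/seteqP; split. Qed.

Lemma cylinder1 (i : V) z : cylinder [fset i]%fset z = spin_at i (z i).
Proof.
apply/seteqP; split=> w h; first by apply: h; rewrite inE.
by move=> j; rewrite inE => /eqP ->.
Qed.

Lemma cylinderU (A B : {fset V}) z :
  cylinder (A `|` B)%fset z = cylinder A z `&` cylinder B z.
Proof.
apply/seteqP; split=> [w h|w [h1 h2] i].
  by split=> i iA; apply: h; rewrite inE iA ?orbT.
by rewrite inE => /orP[/h1|/h2].
Qed.

Lemma cylinderI (A B : {fset V}) z z' :
  agree [set` (A `&` B)%fset] z z' ->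
  cylinder A z `&` cylinder B z' = cylinder (A `|` B)%fset (splice A z z').
Proof.
move=> zz'; rewrite cylinderU; congr (_ `&` _); apply: cylinder_agree => i /= iA.
  by rewrite /splice iA.
by rewrite /splice; case: ifP => // iA'; apply/esym/zz'; rewrite /= inE iA' iA.
Qed.

Lemma extend_restrict (A : {fset V}) w : agree [set` A] (extend (restrict A w)) w.
Proof. by move=> i /= iA; rewrite /extend insubT ffunE. Qed.

Lemma restrict_extend (A : {fset V}) (x : {ffun A -> spin}) :
  restrict A (extend x) = x.
Proof. by apply/ffunP => a; rewrite ffunE /extend valK. Qed.

Lemma in_cylinder_extend (A : {fset V}) (x : {ffun A -> spin}) w :
  (w \in cylinder A (extend x)) = (restrict A w == x).
Proof.
apply/idP/eqP => [|<-].
  rewrite inE => h; rewrite -[RHS]restrict_extend; apply/ffunP => a.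
  by rewrite !ffunE h // (valP a).
by rewrite inE => i iA; rewrite extend_restrict.
Qed.

(** Such a set is a union of cylinders over finitely many patterns, however it was defined. *)
Lemma finite_dimensional_set (A : {fset V}) (S : set (Omega V)) :
  (forall w w', agree [set` A] w w' -> S w -> S w') -> measurable S.
Proof.
move=> hS; have -> : S =
    \bigcup_(x in [set x : {ffun A -> spin} | S (extend x)]) cylinder A (extend x).
  apply/seteqP; split=> [w Sw|w [x Sx xw]].
    exists (restrict A w); last by apply/set_mem; rewrite in_cylinder_extend.
    by apply: hS Sw => i iA; rewrite extend_restrict.
  by apply: hS Sx => i iA; rewrite xw.
apply: fin_bigcup_measurable; first exact: finite_finset.
by move=> x _; exact: measurable_cylinder.
Qed.

Lemma finite_dimensional_sum (R : realType) (A : {fset V}) (F : Omega V -> R) :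
  (forall w w', agree [set` A] w w' -> F w = F w') ->
  forall w, F w =
    \sum_(x : {ffun A -> spin}) F (extend x) * \1_(cylinder A (extend x)) w.
Proof.
move=> hF w; rewrite (bigD1 (restrict A w)) //= big1 => [|x].
  rewrite addr0 indicE in_cylinder_extend eqxx mulr1; apply/hF => i iA.
  by rewrite extend_restrict.
by rewrite indicE in_cylinder_extend eq_sym => /negbTE ->; rewrite mulr0.
Qed.

(** Dynkin's pi-lambda theorem. The empty set joins the cylinders to form a pi-system: two cylinders
    meet in a cylinder if they agree on their common sites, and are disjoint otherwise. *)
Lemma cylinder_induction (Q : set (Omega V) -> Prop) :
  Q set0 -> (forall A z, Q (cylinder A z)) ->
  (forall B C, measurable B -> measurable C -> C `<=` B -> Q B -> Q C ->
     Q (B `\` C)) ->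
  (forall F : (set (Omega V))^nat, (forall n, measurable (F n)) ->
     nondecreasing_seq F -> (forall n, Q (F n)) -> Q (\bigcup_n F n)) ->
  forall B, measurable B -> Q B.
Proof.
move=> Q0 Qcyl QD Qbig B mB.
pose G : set (set (Omega V)) :=
  [set C | C = set0 \/ exists A z, C = cylinder A z].
pose H : set (set (Omega V)) := [set C | measurable C /\ Q C].
suff : H B by case.
apply: (@lambda_system_subset _ G _ setT H).
- move=> C D [->|[A [z ->]]]; first by left; rewrite set0I.
  case=> [->|[A' [z' ->]]]; first by left; rewrite setI0.
  have [zz'|] := pselect (agree [set` (A `&` A')%fset] z z').
    by right; exists (A `|` A')%fset, (splice A z z'); rewrite cylinderI.
  move=> /existsNP[i] /not_implyP[/=]; rewrite inE => /andP[iA iA'] ne.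
  by left; apply/seteqP; split=> // w [h h']; apply: ne; rewrite -h // -h'.
- split=> //.
  + split; first exact: measurableT.
    by rewrite -(cylinder0 (fun=> point)); exact: Qcyl.
  + move=> C D DC [mC QC] [mD QD']; split; first exact: measurableD.
    exact: QD.
  + move=> F ndF HF; split.
      by apply: bigcup_measurable => k _; case: (HF k).
    by apply: Qbig => // k; case: (HF k).
- move=> _ [->|[A [z ->]]]; first by split; [exact: measurable0|].
  by split; [exact: measurable_cylinder|exact: Qcyl].
- by [].
- apply: sub_sigma_algebra2 mB => _ [i _ [x _ <-]]; right.
  by exists [fset i]%fset, (fun=> x); rewrite cylinder1.
Qed.

End FiniteDimensional.

Definition pr (V : choiceType) (R : realType) (mu : probability (Omega V) R)
  (B : set (Omega V)) : R := fine (mu B).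

(** * Real-valued probabilities and finite partitions *)

Section Probability.
Context (V : choiceType) (R : realType) (mu : probability (Omega V) R).

Lemma prE (B : set (Omega V)) : measurable B -> mu B = (pr mu B)%:E.
Proof. by move=> mB; rewrite /pr fineK // fin_num_measure. Qed.

Lemma pr_ge0 B : 0 <= pr mu B.
Proof. by rewrite /pr fine_ge0. Qed.

Lemma pr_le1 (B : set (Omega V)) : measurable B -> pr mu B <= 1.
Proof. by move=> mB; rewrite -lee_fin -prE // probability_le1. Qed.

Lemma le_pr (B C : set (Omega V)) : measurable B -> measurable C -> B `<=` C ->
  pr mu B <= pr mu C.
Proof. by move=> mB mC BC; rewrite -lee_fin -!prE // le_measure ?inE. Qed.

Lemma prT : pr mu setT = 1.
Proof. by rewrite /pr probability_setT. Qed.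

Lemma pr0 : pr mu set0 = 0.
Proof. by rewrite /pr measure0. Qed.

Lemma pr_setD (B C : set (Omega V)) : measurable B -> measurable C -> C `<=` B ->
  pr mu (B `\` C) = pr mu B - pr mu C.
Proof.
move=> mB mC CB; apply: EFin_inj; rewrite EFinB -!prE //; last exact: measurableD.
by rewrite measureD // ?setIidr // ltey_eq fin_num_measure.
Qed.

Lemma integral_indic_sum (I : finType) (c : I -> R) (B : I -> set (Omega V)) D :
  measurable D -> (forall i, measurable (B i)) ->
  (\int[mu]_(w in D) (\sum_i c i * \1_(B i) w)%:E)%E
  = (\sum_i c i * pr mu (B i `&` D))%:E.
Proof.
move=> mD mB; under eq_integral do rewrite -sumEFin.
have int i : mu.-integrable D (fun w => (\1_(B i) w)%:E).
  by apply: integrableS (integrable_indic _ _).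
rewrite integral_sum //; last by move=> i; exact: (integrableZl mD (c i) (int i)).
rewrite -sumEFin; apply: eq_bigr => i _.
under eq_integral do rewrite EFinM.
rewrite integralZl // integral_indic // EFinM; congr (_ * _)%E.
by apply: prE; exact: measurableI.
Qed.

Lemma pr_split (I : finType) (g : Omega V -> I) (B : set (Omega V)) :
  measurable B -> (forall a, measurable (g @^-1` [set a])) ->
  pr mu B = \sum_a pr mu (B `&` g @^-1` [set a]).
Proof.
move=> mB mg; have mBg a : measurable (B `&` g @^-1` [set a]) by exact: measurableI.
apply: EFin_inj; rewrite -prE // -[in LHS](setIT B) -integral_indic //.
have -> : \sum_a pr mu (B `&` g @^-1` [set a]) =
    \sum_a 1 * pr mu (B `&` g @^-1` [set a] `&` setT).
  by apply: eq_bigr => a _; rewrite mul1r setIT.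
rewrite -integral_indic_sum //; apply: eq_integral => w _; congr EFin.
rewrite (bigD1 (g w)) //= big1 => [|a ne].
  rewrite mul1r addr0 !indicE; congr (_%:R); congr nat_of_bool.
  by apply/idP/idP; rewrite !inE => //= -[].
by rewrite mul1r indicE memNset //= => -[_ /= E]; rewrite E eqxx in ne.
Qed.

Lemma pr_split_spin (B : set (Omega V)) i : measurable B ->
  pr mu B = \sum_a pr mu (B `&` spin_at i a).
Proof.
by move=> mB; apply: (@pr_split _ (fun w => w i)) => // a; exact: measurable_spin_at.
Qed.

End Probability.

(** * The set of bad configurations *)

(** The supremum in [oscillation] exceeds [eps] exactly when this holds for some [D] containing [L];
    no extended reals remain. *)
Definition oscillates (V : choiceType) (R : realType)
    (nu : probability (Omega V) R) (f : Omega V -> R) (eta : Omega V)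
    (L0 : {fset V}) (eps : R) (L D : {fset V}) : Prop :=
  exists xi1 xi2 : Omega V, let A := ((L `\` L0) `|` (D `\` L))%fset in
    eps < `|cond_expectation nu f A (splice L eta xi1)
            - cond_expectation nu f A (splice L eta xi2)|.

Section Bad.
Context (V : choiceType) (R : realType) (nu : probability (Omega V) R).

Lemma limsup_oscillation_gt0 f eta L0 :
  (0 < fset_limsup (oscillation nu f eta L0))%E <->
  exists2 eps : R, 0 < eps & forall M : {fset V}, exists L D : {fset V},
    [/\ (M `<=` L)%fset, (L `<=` D)%fset & oscillates nu f eta L0 eps L D].
Proof.
split=> [|[eps eps0 H]].
  rewrite /fset_limsup; set S := (X in ereal_inf X) => inf0.
  (* Half the infimum if it is finite, and 1 if it is infinite. *)
  have [eps eps0 Heps] : exists2 eps : R, 0 < eps & (eps%:E < ereal_inf S)%E.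
    move: inf0; case: (ereal_inf S) => [r| |] // r0.
      by rewrite lte_fin in r0; exists (r / 2); rewrite ?lte_fin; lra.
    by exists 1 => //; rewrite ltry.
  exists eps => // M; have : (eps%:E < ereal_sup
      [set oscillation nu f eta L0 L | L in [set L | (M `<=` L)%fset]])%E.
    by apply: lt_le_trans Heps _; apply: ereal_inf_lbound; exists M.
  move=> /ereal_sup_gt[_ [L ML <-]] /ereal_sup_gt[_ [xi1 [xi2 [D [LD ->]]]]].
  rewrite lte_fin => h; exists L, D; split=> //; by exists xi1, xi2.
apply: (@lt_le_trans _ _ eps%:E); first by rewrite lte_fin.
apply: le_ereal_inf_tmp => _ [M _ <-]; have [L [D [ML LD [xi1 [xi2 h]]]]] := H M.
apply: (@le_trans _ _ (oscillation nu f eta L0 L)); last first.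
  by apply: ereal_sup_ubound; exists L.
apply: le_trans (ltW h : (_%:E <= _%:E)%E) _.
by apply: ereal_sup_ubound; exists xi1, xi2, D.
Qed.

Lemma local_agree (f : Omega V -> R) : is_local f -> exists L : {fset V},
  forall w w', agree [set` L] w w' -> f w = f w'.
Proof.
move=> [L mf]; exists L => w w' ww'; apply/esym.
have := mf measurableT _ (measurable_set1 (f w)); rewrite setTI => h.
exact: (F_agree h ww').
Qed.

Lemma local_cylinder (L : {fset V}) z : is_local (\1_(cylinder L z) : _ -> R).
Proof.
exists L; apply: (@measurable_indic _ (g_sigma_algebraType (coord_events _))).
exact: F_cylinder.
Qed.

Lemma cond_expectation_indic (C : set (Omega V)) A z : measurable C ->
  cond_expectation nu \1_C A z
  = pr nu (C `&` cylinder A z) / pr nu (cylinder A z).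
Proof.
move=> mC; rewrite /cond_expectation /Rintegral integral_indic //.
exact: measurable_cylinder.
Qed.

Lemma cond_expectation_sum (f : Omega V -> R) (L : {fset V}) A z :
  (forall w w', agree [set` L] w w' -> f w = f w') ->
  cond_expectation nu f A z = \sum_(x : {ffun L -> spin})
    f (extend x) * cond_expectation nu \1_(cylinder L (extend x)) A z.
Proof.
move=> hf; rewrite /cond_expectation /Rintegral.
under eq_integral do rewrite (finite_dimensional_sum hf).
rewrite integral_indic_sum; last 2 first.
- exact: measurable_cylinder.
- by move=> x; exact: measurable_cylinder.
rewrite /= mulr_suml; apply: eq_bigr => x _.
rewrite integral_indic ?mulrA //; exact: measurable_cylinder.
Qed.

(** Badness at threshold [eps], tested on one cylinder indicator. With thresholds [1 / (k + 1)] only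
    countably many such sets are needed. *)
Definition bad_witness (L1 : {fset V}) (x : {ffun L1 -> spin}) (L0 : {fset V})
    (eps : R) : set (Omega V) :=
  [set eta | forall M : {fset V}, exists L D : {fset V},
    [/\ (M `<=` L)%fset, (L `<=` D)%fset &
      oscillates nu \1_(cylinder L1 (extend x)) eta L0 eps L D]].

Lemma bad_configurationsE eta : bad_configurations nu eta <->
  exists (L1 : {fset V}) (x : {ffun L1 -> spin}) (L0 : {fset V}) (eps : R),
    0 < eps /\ bad_witness x L0 eps eta.
Proof.
split=> [[f [L0 [/local_agree[L1 hf]]]]|]; last first.
  move=> [L1 [x [L0 [eps [eps0 h]]]]].
  exists \1_(cylinder L1 (extend x)), L0; split; first exact: local_cylinder.
  by apply/limsup_oscillation_gt0; exists eps.
move=> /limsup_oscillation_gt0[eps eps0 H].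
pose S := \sum_(x : {ffun L1 -> spin}) `|f (extend x)|.
have S0 : 0 <= S by apply: sumr_ge0.
have S1 : 0 < S + 1 by lra.
(* If each cylinder indicator oscillated by at most [eps'], then [f] would by at most [S * eps'],
   which is less than [eps]. The [+ 1] avoids a zero denominator. *)
pose eps' := eps / (S + 1).
have eps'0 : 0 < eps' by rewrite divr_gt0.
apply: contrapT => not_bad.
have good (x : {ffun L1 -> spin}) : exists M : {fset V}, forall L D : {fset V},
    (M `<=` L)%fset -> (L `<=` D)%fset ->
    ~ oscillates nu \1_(cylinder L1 (extend x)) eta L0 eps' L D.
  apply: contrapT => /forallNP h; apply: not_bad.
  exists L1, x, L0, eps'; split=> // M; apply: contrapT => h'; apply: (h M).
  by move=> L D ML LD o; apply: h'; exists L, D.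
have [M hM] := choice good.
(* Beyond this union of finite sets all the indicators are good simultaneously. *)
have [L [D [ML LD [xi1 [xi2 /=]]]]] := H (\bigcup_(x <- enum {ffun L1 -> spin}) M x)%fset.
apply/negP; rewrite -leNgt !(cond_expectation_sum _ _ hf) -sumrB.
apply: (le_trans (ler_norm_sum _ _ _)).
apply: (@le_trans _ _ (\sum_(x : {ffun L1 -> spin}) `|f (extend x)| * eps')).
  apply: ler_sum => x _; rewrite -mulrBr normrM ler_wpM2l // leNgt.
  apply/negP => h; apply: (hM x L D) => //; last by exists xi1, xi2.
  by apply: fsubset_trans ML; apply: bigfcup_sup; rewrite ?mem_enum.
by rewrite -mulr_suml -/S /eps' mulrCA ger_pMr // ler_pdivrMr // mul1r; lra.
Qed.

Lemma bad_witnessW (L1 : {fset V}) (x : {ffun L1 -> spin}) L0 eps eps' : eps' <= eps ->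
  bad_witness x L0 eps `<=` bad_witness x L0 eps'.
Proof.
move=> le_eps eta h M; have [L [D [ML LD [xi1 [xi2 o]]]]] := h M.
by exists L, D; split=> //; exists xi1, xi2; apply: le_lt_trans o.
Qed.

(** An injection into [nat] carries finite subsets injectively to finite sets of naturals, a
    countable type. *)
Lemma countable_fsets : countable [set: V] -> countable [set: {fset V}].
Proof.
move=> /countable_injP[f f_inj]; apply/countable_injP.
exists (fun A : {fset V} => @choice.pickle {fset nat} (f @` A)%fset) => A B _ _.
move=> /(pcan_inj (@choice.pickleK _)) AB.
have mem_f (C : {fset V}) i : (i \in C) = (f i \in (f @` C)%fset).
  by rewrite mem_imfset // => x y; apply: f_inj; rewrite inE.
by apply/fsetP => i; rewrite !mem_f AB.
Qed.

(** The quantifiers over finite sets and thresholds are countable. The one over boundary conditions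
    is not, but for fixed [L] and [D] the condition reads [eta] only on [L], so it is
    finite-dimensional. *)
Lemma measurable_bad : countable [set: V] -> measurable (bad_configurations nu).
Proof.
move=> /countable_fsets cF.
have -> : bad_configurations nu = bigcup setT (fun L1 : {fset V} =>
    bigcup setT (fun x : {ffun L1 -> spin} => \bigcup_L0 \bigcup_k
    bad_witness x L0 k.+1%:R^-1)).
  apply/seteqP; split=> eta.
    move=> /bad_configurationsE[L1 [x [L0 [eps [eps0 h]]]]].
    exists L1 => //; exists x => //; exists L0 => //.
    have [k] := ltr_add_invr eps0; rewrite add0r => hk.
    by exists k => //; exact: bad_witnessW (ltW hk) _ h.
  move=> [L1 _ [x _ [L0 _ [k _ h]]]]; apply/bad_configurationsE.
  by exists L1, x, L0, k.+1%:R^-1; split=> //; rewrite invr_gt0 ltr0n.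
apply: countable_bigcupT_measurable => // L1.
apply: fin_bigcup_measurable; first exact: finite_finset.
move=> x _; apply: countable_bigcupT_measurable => // L0.
apply: bigcup_measurable => k _; set eps := k.+1%:R^-1.
have -> : bad_witness x L0 eps = ~` bigcup setT (fun M : {fset V} =>
    ~` \bigcup_L \bigcup_D [set eta | [/\ (M `<=` L)%fset, (L `<=` D)%fset &
      oscillates nu \1_(cylinder L1 (extend x)) eta L0 eps L D]]).
  rewrite setC_bigcup; under eq_bigcapr do rewrite setCK.
  apply/seteqP; split=> [eta h M _|eta h M].
    by have [L [D o]] := h M; exists L => //; exists D.
  by have [L _ [D _ o]] := h M I; exists L, D.
apply: measurableC; apply: countable_bigcupT_measurable => // M.
apply: measurableC; apply: countable_bigcupT_measurable => // L.
apply: countable_bigcupT_measurable => // D.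
apply: (@finite_dimensional_set _ L) => w w' ww' /= [ML LD [xi1 [xi2 o]]].
split=> //; exists xi1, xi2.
suff E xi : splice L w' xi = splice L w xi by rewrite !E.
by apply/funext => i; rewrite /splice; case: ifP => // iL; rewrite ww'.
Qed.

(** * Badness is preserved by measure-preserving relabellings *)

Section Invariance.
Context (phi psi : V -> V).
Hypotheses (phiK : cancel phi psi) (psiK : cancel psi phi).
Hypothesis inv : forall B : set (Omega V), measurable B ->
  nu [set w : Omega V | B (w \o phi)] = nu B.

Lemma cylinder_comp A (z : Omega V) :
  [set w : Omega V | cylinder A z (w \o phi)] = cylinder (phi @` A)%fset (z \o psi).
Proof.
apply/seteqP; split=> w h i.
  by move=> /imfsetP[j /= jA ->]; rewrite /= phiK; exact: h.
by move=> iA; rewrite /= h ?in_imfset //= phiK.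
Qed.

(** The whole witness is transported: finite sets by [phi], configurations by [psi]. Conditional
    probabilities do not change, by invariance of [nu]. *)
Lemma bad_comp eta : bad_configurations nu (eta \o phi) -> bad_configurations nu eta.
Proof.
move=> /bad_configurationsE[L1 [x [L0 [eps [eps0 h]]]]].
exists \1_(cylinder (phi @` L1)%fset (extend x \o psi)), (phi @` L0)%fset.
split; first exact: local_cylinder.
apply/limsup_oscillation_gt0; exists eps => // M.
have [L [D [ML LD [xi1 [xi2 o]]]]] := h (psi @` M)%fset.
have phi_inj := can_inj phiK.
have memE (A : {fset V}) i : (i \in (phi @` A)%fset) = (psi i \in A).
  by rewrite -{1}[i]psiK mem_imfset.
exists (phi @` L)%fset, (phi @` D)%fset; split.
- apply/fsubsetP => i iM; rewrite -[i]psiK in_imfset //=.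
  by apply: (fsubsetP ML); rewrite in_imfset.
- by apply/fsubsetP => i; rewrite !memE; exact: (fsubsetP LD).
exists (xi1 \o psi), (xi2 \o psi); move: o => /=.
set A := ((_ `\` _) `|` _)%fset; set A' := ((_ `\` (phi @` L0)) `|` _)%fset.
have -> : A' = (phi @` A)%fset.
  by apply/fsetP => i; rewrite memE !inE !memE.
have spliceE xi : splice (phi @` L)%fset eta (xi \o psi) = splice L (eta \o phi) xi \o psi.
  by apply/funext => i; rewrite /splice /= memE psiK.
have mcyl := @measurable_cylinder V.
have condE z : cond_expectation nu \1_(cylinder (phi @` L1)%fset (extend x \o psi))
    (phi @` A)%fset (z \o psi) = cond_expectation nu \1_(cylinder L1 (extend x)) A z.
  rewrite !cond_expectation_indic // -!cylinder_comp /pr -(inv (mcyl A z)).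
  by rewrite -(inv (measurableI _ _ (mcyl L1 (extend x)) (mcyl A z))).
by rewrite !spliceE !condE.
Qed.

End Invariance.

End Bad.

(** * Mixing of the Markov chain *)

(* Splitting off the constant [delta] from the kernel leaves a nonnegative
   kernel of total mass [1 - #|I| * delta], and does not affect [v P]. *)
Lemma stochastic_contraction (R : realType) (I : finType) (P : I -> I -> R)
    (delta : R) (v : I -> R) :
  (forall a b, delta <= P a b) -> (forall a, \sum_b P a b = 1) ->
  \sum_a v a = 0 ->
  \sum_b `|\sum_a v a * P a b| <= (1 - #|I|%:R * delta) * \sum_a `|v a|.
Proof.
move=> le_P sum_P sum_v.
have E b : \sum_a v a * P a b = \sum_a v a * (P a b - delta).
  under [RHS]eq_bigr do rewrite mulrBr.
  by rewrite sumrB -mulr_suml sum_v mul0r subr0.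
apply: (@le_trans _ _ (\sum_b \sum_a `|v a| * (P a b - delta))).
  apply: ler_sum => b _; rewrite E; apply: (le_trans (ler_norm_sum _ _ _)).
  by apply: ler_sum => a _; rewrite normrM (@ger0_norm _ (_ - _)) // subr_ge0.
rewrite exchange_big /= mulr_sumr; apply: ler_sum => a _.
by rewrite -mulr_sumr sumrB sum_P sumr_const -[delta *+ _]mulr_natl mulrC.
Qed.

Section Markov.
Context (R : realType) (V : choiceType) (d : nat) (e : rel V).
Context (mu : probability (Omega V) R) (P : spin -> spin -> R).
Hypothesis tree : is_cayley_tree d e.
Hypothesis markov : is_tree_markov_chain e mu.
Hypothesis transition : is_transition_matrix e mu P.
Hypothesis P_gt0 : forall x y, 0 < P x y.
Context (o : V) (par : V -> V) (dep : V -> nat).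
Hypothesis rt : rooting e o par dep.

Local Notation pr := (pr mu).
Local Notation mcyl := measurable_cylinder.
Local Notation mspin := measurable_spin_at.

Lemma ex_neighbour i : exists j, e i j.
Proof.
have [->|io] := eqVneq i o; last by exists (par i); exact: (edge_par rt).
have [j hj] := ex_dep tree rt 1; have jo : j != o.
  by apply/eqP => jo; move: hj; rewrite jo (dep_root rt).
exists j; rewrite (tree_sym tree); have := edge_par rt jo.
by move: hj; rewrite (dep_par rt jo) => -[/(dep_eq0 rt) ->].
Qed.

Lemma pr_spin_at_gt0 i a : 0 < pr (spin_at i a).
Proof.
rewrite lt_neqAle pr_ge0 andbT eq_sym; apply/eqP => i0.
(* Division by zero yields 0, so a null event at [i] would force [P a a] to vanish. *)
have [j eij] := ex_neighbour i; have := P_gt0 a a.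
by rewrite (transition eij) -[fine (mu (spin_at i a))]/(pr _) i0 invr0 mulr0 ltxx.
Qed.

Lemma transition_sum a : \sum_b P a b = 1.
Proof.
have [j eoj] := ex_neighbour o; under eq_bigr do rewrite (transition eoj).
rewrite -mulr_suml; under eq_bigr do rewrite setIC.
by rewrite -pr_split_spin ?divff ?gt_eqF ?pr_spin_at_gt0 //; exact: mspin.
Qed.

(** The conditional probability is integrated over [X] and the event of spin [a] at [i]. There the
    version [h], measurable for the spin at [i], is a constant, and the case of the whole space
    identifies that constant as [P a b]. *)
Lemma markov_edge i j X a b : e i j -> F_ (past e i j) X ->
  pr (X `&` spin_at i a `&` spin_at j b) = pr (X `&` spin_at i a) * P a b.
Proof.
move=> eij FX; have [g [h [[_ int_g g_cond] [Fh int_h _] gh]]] := markov eij b.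
pose c := h (fun=> a).
have h_const w : spin_at i a w -> h w = c.
  move=> wi; have := Fh measurableT _ (measurable_set1 c); rewrite setTI => Fc.
  by apply: (F_agree Fc (w := fun=> a)) => // k /= ->; rewrite wi.
have past_i : past e i j i.
  exists [::]; split=> //; rewrite inE; apply/eqP => ij.
  by move: eij; rewrite ij (tree_irr tree).
have key Y : F_ (past e i j) Y ->
    pr (Y `&` spin_at i a `&` spin_at j b) = c * pr (Y `&` spin_at i a).
  move=> FY; set B := Y `&` spin_at i a.
  have FB : F_ (past e i j) B by apply: F_setI => //; exact: F_spin_at.
  have mB := F_measurableE FB.
  apply: EFin_inj; rewrite -prE; last by apply: measurableI => //; exact: mspin.
  rewrite setIC -g_cond //.
  have -> : (\int[mu]_(w in B) (g w)%:E = \int[mu]_(w in B) (h w)%:E)%E.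
    apply: ae_eq_integral => //.
    - apply: measurable_funS (measurable_int _ int_g) => //.
    - apply: measurable_funS (measurable_int _ int_h) => //.
    - by apply: filterS gh => w /= ->.
  rewrite EFinM -prE // -integral_cst //; apply: eq_integral => w.
  by rewrite inE => -[_ /h_const ->].
have := key setT; rewrite !setTI => keyT.
rewrite key // mulrC (transition eij).
rewrite [spin_at j b `&` _]setIC.
rewrite -[fine (mu (_ `&` _))]/(pr (spin_at i a `&` spin_at j b)).
rewrite keyT; last exact: F_setT.
by rewrite mulfK // gt_eqF // pr_spin_at_gt0.
Qed.

Lemma markov_par j X a b : j != o -> F_ (~` descendants par j) X ->
  pr (X `&` spin_at (par j) a `&` spin_at j b)
  = pr (X `&` spin_at (par j) a) * P a b.
Proof.
move=> jo FX; apply: markov_edge; first by rewrite (tree_sym tree) (edge_par rt).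
by apply: sub_F FX => k; exact: (past_par tree rt).
Qed.

Lemma transition_lower_bound : exists2 delta : R,
  0 < delta < 1 & forall a b, delta <= P a b.
Proof.
case: (@arg_minP _ R (spin * spin)%type (point, point) xpredT
  (fun ab => P ab.1 ab.2)) => //.
(* The least entry is at most 1; halving it makes [delta < 1] strict. *)
move=> [a b] _ /= h; exists (P a b / 2) => [|a' b'].
  have P1 : P a b <= 1.
    rewrite -(transition_sum a) (bigD1 b) //= lerDl sumr_ge0 // => b' _.
    exact: ltW.
  by have := P_gt0 a b; lra.
by have := h (a', b') isT; have := P_gt0 a b; rewrite /=; lra.
Qed.

(** The second index set consists of all vertices other than the strict descendants of [r], which
    are deeper than [r]. *)
Lemma level_F n r E : F_ [set k | (dep k <= n)%N] E -> (n <= dep r)%N ->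
  F_ [set k | descendants par r k -> k = r] E.
Proof.
move=> FE nr; apply: sub_F FE => k /= kn /(descendants_dep_eq rt); apply.
exact: leq_trans nr.
Qed.

(** The error vector at [r] is the one at [par r] multiplied by [P], and its entries sum to zero, so
    each generation contracts it by [1 - delta]. *)
Lemma chain_decay delta n E :
  0 < delta < 1 -> (forall a b, delta <= P a b) ->
  F_ [set k | (dep k <= n)%N] E -> forall m r, dep r = (n + m)%N ->
  \sum_a `|pr (E `&` spin_at r a) - pr E * pr (spin_at r a)|
  <= 2 * (1 - delta) ^+ m.
Proof.
move=> /andP[delta0 delta1] le_P FE; have mE := F_measurableE FE.
elim=> [|m IH] r hr.
  rewrite expr0 mulr1; apply: (@le_trans _ _ (\sum_a
      (pr (E `&` spin_at r a) + pr E * pr (setT `&` spin_at r a)))).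
    apply: ler_sum => a _; rewrite setTI; apply: (le_trans (ler_normB _ _)).
    by rewrite !ger0_norm ?mulr_ge0 ?pr_ge0.
  rewrite big_split /= -mulr_sumr -(pr_split_spin mu r mE).
  rewrite -(pr_split_spin mu r measurableT).
  by rewrite prT mulr1; have := pr_le1 mu mE; lra.
have ro : r != o by apply/eqP => ro; move: hr; rewrite ro (dep_root rt) addnS.
have hp : dep (par r) = (n + m)%N.
  by move: hr; rewrite (dep_par rt ro) addnS => -[].
pose v a := pr (E `&` spin_at (par r) a) - pr E * pr (spin_at (par r) a).
have stepX X b : F_ (~` descendants par r) X ->
    pr (X `&` spin_at r b) = \sum_a pr (X `&` spin_at (par r) a) * P a b.
  move=> FX; have mX := F_measurableE FX.
  rewrite (pr_split_spin _ (par r)); last by apply: measurableI => //; exact: mspin.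
  by apply: eq_bigr => a _; rewrite setIAC markov_par.
have FE' : F_ (~` descendants par r) E.
  apply: sub_F FE => k /= kn /(descendants_dep rt); rewrite hr => h.
  by have := leq_trans h kn; rewrite addnS ltnNge leq_addr.
have step b : pr (E `&` spin_at r b) - pr E * pr (spin_at r b) = \sum_a v a * P a b.
  rewrite stepX // -[spin_at r b]setTI stepX; last exact: F_setT.
  rewrite mulr_sumr -sumrB; apply: eq_bigr => a _.
  by rewrite setTI /v mulrBl mulrA.
under eq_bigr do rewrite step.
apply: (le_trans (stochastic_contraction le_P transition_sum _)).
  rewrite sumrB -mulr_sumr -pr_split_spin //.
  have := pr_split_spin mu (par r) (@measurableT _ (Omega V)).
  by under eq_bigr do rewrite setTI; rewrite prT => <-; rewrite mulr1 subrr.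
rewrite exprS mulrCA.
apply: (le_trans (y := (1 - delta) * \sum_a `|v a|)); last first.
  by rewrite ler_wpM2l ?IH // subr_ge0 ltW.
(* The contraction factor [1 - #|spin| * delta] is at most [1 - delta], as there is at least one
   spin value. *)
rewrite ler_wpM2r ?sumr_ge0 // lerD2l lerN2 ler_peMl ?(ltW delta0) // ler1n.
by apply/card_gt0P; exists point.
Qed.

(* Induction on the total depth: a deepest vertex of D other than r is
   integrated out against P, which replaces it by its parent. *)
Lemma root_cond_indep r E a (D : {fset V}) z :
  F_ [set k | descendants par r k -> k = r] E ->
  [set` D] `<=` descendants par r ->
  pr (E `&` cylinder D z `&` spin_at r a) * pr (spin_at r a)
  = pr (E `&` spin_at r a) * pr (cylinder D z `&` spin_at r a).
Proof.
move=> FE; have mE := F_measurableE FE.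
have [s] := ubnP (\sum_(k <- D) dep k)%N.
elim: s D z => // s IH D z; rewrite ltnS => Ds Dr.
(* Here [D] is empty or just [r], so the cylinder contains the event of spin [a] at [r] or is
   disjoint from it. *)
have [Dr1|] := pselect (forall k, k \in D -> k = r).
  have [rD|rD] := boolP (r \in D); last first.
    have -> : D = fset0.
      by apply/fsetP => k; rewrite inE; apply/negP => kD; rewrite -(Dr1 _ kD) kD in rD.
    by rewrite cylinder0 setIT setTI.
  have -> : D = [fset r]%fset.
    apply/fsetP => k; rewrite inE; apply/idP/eqP => [/Dr1//|->//].
  rewrite cylinder1; have [->|ne] := eqVneq (z r) a.
    by rewrite -setIA setIid.
  have ra0 : spin_at r (z r) `&` spin_at r a = set0.
    by apply/seteqP; split=> // w [/= h1 h2]; rewrite -h1 -h2 eqxx in ne.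
  by rewrite -setIA ra0 setI0 !pr0 mul0r mulr0.
move=> /existsNP[j0 /not_implyP[j0D j0r]].
have [j [jD jr jmax]] : exists j, [/\ j \in D, j != r &
    forall k, k \in D -> (dep k <= dep j)%N].
  case: (@arg_maxnP D [` j0D]%fset xpredT (fun k => dep (val k)) isT) => -[j jD] _ jmax.
  have jm k : k \in D -> (dep k <= dep j)%N.
    by move=> kD; exact: (jmax [` kD]%fset isT).
  exists j; split=> //; apply/eqP => jr; apply: j0r.
  by apply: (descendants_dep_eq rt); [exact: Dr|rewrite -jr jm].
have desc_j : descendants par r j by exact: Dr.
have r_lt_j : (dep r < dep j)%N.
  rewrite ltnNge; apply: contra jr => h; apply/eqP.
  exact: (descendants_dep_eq rt).
have jo : j != o by apply: contraTneq r_lt_j => ->; rewrite (dep_root rt).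
have desc_i : descendants par r (par j).
  by case: (descendants_inv desc_j) => // E'; rewrite E' eqxx in jr.
set i := par j in desc_i *; have hij : dep j = (dep i).+1 := dep_par rt jo.
have ij : i != j.
  by apply/eqP => E'; move: hij; rewrite E' => /eqP; rewrite ltn_eqF.
pose D'' := (i |` (D `\ j))%fset.
have iD'' : i \in D'' by rewrite !inE eqxx.
have memD'' k : k \in D'' -> [/\ descendants par r k, k != j & (dep k <= dep j)%N].
  rewrite !inE => /orP[/eqP->|/andP[kj kD]]; first by split=> //; rewrite hij leqnSn.
  by split=> //; [exact: Dr|exact: jmax].
(* The parent is shallower than [j], and counts only once if it was already in [D], so the total
   depth drops. *)
have sumD'' : (\sum_(k <- D'') dep k < s)%N.
  apply: leq_trans Ds; rewrite [leqRHS](big_fsetD1 j) //= hij.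
  have [iD|iD] := boolP (i \in (D `\ j)%fset).
    rewrite (_ : D'' = (D `\ j)%fset) ?addSn ?ltnS ?leq_addl //.
    by apply/fsetP => k; rewrite in_fset1U; case: eqP => // ->.
  by rewrite /D'' big_fsetU1 //= addSn.
(* Since [j] is deepest in [D] and lies strictly behind [r], the remaining constraints involve no
   descendant of [j], and the Markov property applies at the edge to its parent. *)
have stepX X z' : F_ [set k | descendants par r k -> k = r] X ->
    pr (X `&` cylinder (j |` D'')%fset z' `&` spin_at r a) =
    pr (X `&` cylinder D'' z' `&` spin_at r a) * P (z' i) (z' j).
  move=> FX; set Y := X `&` cylinder D'' z' `&` spin_at r a.
  have Yi : Y = Y `&` spin_at i (z' i).
    by apply/seteqP; split=> [w Yw|w []//]; split=> //; apply: Yw.1.2.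
  rewrite cylinderU cylinder1 [spin_at _ _ `&` _]setIC setIA setIAC -/Y Yi.
  apply: markov_par => //; apply: F_setI; first apply: F_setI.
  - apply: sub_F FX => k /= kr jk; have := descendants_dep rt jk.
    by rewrite (kr (descendants_trans desc_j jk)) leqNgt r_lt_j.
  - apply: F_cylinder => k /memD''[_ kj kd] /(descendants_dep_eq rt)/(_ kd) kj'.
    by rewrite kj' eqxx in kj.
  - by apply: F_spin_at => /(descendants_dep rt); rewrite leqNgt r_lt_j.
have indep z' : pr (E `&` cylinder (j |` D'')%fset z' `&` spin_at r a) * pr (spin_at r a)
    = pr (E `&` spin_at r a) * pr (cylinder (j |` D'')%fset z' `&` spin_at r a).
  have := stepX setT z' (@F_setT V [set k | descendants par r k -> k = r]); rewrite !setTI => ->.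
  rewrite stepX // mulrAC IH //; first by rewrite mulrA.
  by move=> k /memD''[].
have jD'' : (j |` D'' = i |` D)%fset.
  apply/fsetP => k; rewrite !inE; have [->|kj] := eqVneq k j; first by rewrite jD orbT.
  by [].
rewrite jD'' in indep.
have [iD|iD] := boolP (i \in D).
  by move: (indep z); rewrite (_ : i |` D = D)%fset //; apply/fsetUidPr; rewrite fsub1set.
(* If the parent is a new site, the identity with its spin prescribed is summed over that spin. *)
have splitE b : cylinder (i |` D)%fset (splice D z (fun=> b)) = cylinder D z `&` spin_at i b.
  rewrite fsetUC -cylinderI ?cylinder1 // => k /=; rewrite !inE => /andP[kD /eqP ki].
  by rewrite -ki kD in iD.
have mD : measurable (cylinder D z `&` spin_at r a).
  by apply: measurableI; [exact: mcyl|exact: mspin].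
rewrite -setIA (pr_split_spin mu i (measurableI _ _ mE mD)) (pr_split_spin mu i mD).
rewrite mulr_suml mulr_sumr; apply: eq_bigr => b _.
rewrite -(setIA E) [cylinder D z `&` _ `&` _]setIAC -splitE setIA.
exact: indep.
Qed.

(** Given the spin [a] at [r], the cylinder contributes a factor [q / p] in [[0, 1]] whether or not
    [E] is imposed, so the error is at most that of the spin at [r]. *)
Lemma chain_mixing delta n m r E (D : {fset V}) z :
  0 < delta < 1 -> (forall a b, delta <= P a b) ->
  F_ [set k | (dep k <= n)%N] E -> dep r = (n + m)%N ->
  [set` D] `<=` descendants par r ->
  `|pr (E `&` cylinder D z) - pr E * pr (cylinder D z)| <= 2 * (1 - delta) ^+ m.
Proof.
move=> delta01 le_P FE hr Dr; have mE := F_measurableE FE.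
have FE' : F_ [set k | descendants par r k -> k = r] E.
  by apply: level_F FE _; rewrite hr leq_addr.
apply: le_trans (chain_decay delta01 le_P FE hr).
rewrite (pr_split_spin mu r (measurableI _ _ mE (mcyl D z))).
rewrite (pr_split_spin mu r (mcyl D z)) mulr_sumr -sumrB.
apply: (le_trans (ler_norm_sum _ _ _)); apply: ler_sum => a _.
set p := pr (spin_at r a); have p0 : 0 < p := pr_spin_at_gt0 r a.
set q := pr (cylinder D z `&` spin_at r a).
have -> : pr (E `&` cylinder D z `&` spin_at r a) = pr (E `&` spin_at r a) * (q / p).
  by rewrite mulrA -(root_cond_indep a z FE' Dr) mulfK // gt_eqF.
have -> : pr E * q = pr E * p * (q / p).
  by rewrite -mulrA; congr (_ * _); rewrite mulrC divfK // gt_eqF.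
rewrite -mulrBl normrM ler_piMr // ger0_norm ?divr_ge0 ?pr_ge0 //.
rewrite ler_pdivrMr // mul1r; apply: le_pr; last by move=> w [].
- by apply: measurableI; [exact: mcyl|exact: mspin].
- exact: mspin.
Qed.

End Markov.

(** * Ergodicity *)

Lemma geometric_cvg (R : realType) (c C l : R) (u : nat -> R) : `|c| < 1 ->
  (forall m, `|u m - l| <= C * c ^+ m) -> u @ \oo --> l.
Proof.
move=> c1 hu; apply/cvgrPdist_le => eps eps0.
have := @cvg_geometric R C c c1; move=> /cvgrPdist_le /(_ _ eps0).
apply: filterS => m; rewrite sub0r normrN => h; rewrite distrC.
exact: le_trans (hu m) (le_trans (ler_norm _) h).
Qed.

(* Convergence of a family of dominated finitely additive set functions
   propagates from cylinders to the sigma-algebra: the domination makes the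
   approximation of an increasing union uniform in the index [m]. *)
Lemma dominated_setfun_cvg (R : realType) (V : choiceType)
    (nu : probability (Omega V) R) (a : nat -> set (Omega V) -> R)
    (b : set (Omega V) -> R) :
  (forall m B C, measurable B -> measurable C -> C `<=` B ->
     a m (B `\` C) = a m B - a m C) ->
  (forall B C, measurable B -> measurable C -> C `<=` B ->
     b (B `\` C) = b B - b C) ->
  (forall m B, measurable B -> 0 <= a m B <= pr nu B) ->
  (forall B, measurable B -> 0 <= b B <= pr nu B) ->
  (forall A z, a ^~ (cylinder A z) @ \oo --> b (cylinder A z)) ->
  forall B, measurable B -> a ^~ B @ \oo --> b B.
Proof.
move=> aD bD a_le b_le acyl; apply: cylinder_induction => //.
- have a0 m : a m set0 = 0.
    have /andP[h1 h2] := a_le m _ measurable0; rewrite pr0 in h2.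
    by apply/eqP; rewrite eq_le h1 h2.
  have -> : b set0 = 0.
    have /andP[h1 h2] := b_le _ measurable0; rewrite pr0 in h2.
    by apply/eqP; rewrite eq_le h1 h2.
  by under eq_fun do rewrite a0; exact: cvg_cst.
- move=> B C mB mC CB aB aC; rewrite bD //.
  under eq_fun do rewrite aD //.
  exact: cvgB.
move=> F mF ndF aF; have mU : measurable (\bigcup_n F n) by exact: bigcup_measurable.
apply/cvgrPdist_le => eps eps0; have eps3 : 0 < eps / 3 by lra.
(* By domination, replacing the union by [F k] costs at most [eps / 3] in [b] and in [a m], for
   every [m]. *)
have [k hk] : exists k, pr nu ((\bigcup_n F n) `\` F k) <= eps / 3.
  have := nondecreasing_cvg_mu (mu := nu) mF mU ndF.
  rewrite [X in _ --> X](prE nu mU) => /fine_cvg /cvgrPdist_le /(_ _ eps3) [k _ h].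
  exists k; rewrite pr_setD //; last exact: bigcup_sup.
  exact: le_trans (ler_norm _) (h k (leqnn k)).
have subF : F k `<=` \bigcup_n F n by exact: bigcup_sup.
have mD : measurable ((\bigcup_n F n) `\` F k) by exact: measurableD.
move/cvgrPdist_le: (aF k) => /(_ _ eps3); apply: filterS => m.
have := a_le m _ mD; rewrite aD // => /andP[a1 a2].
have := b_le _ mD; rewrite bD // => /andP[b1 b2].
by rewrite !ler_norml => /andP[h1 h2]; apply/andP; split; lra.
Qed.

Section Ergodicity.
Context (R : realType) (V : choiceType) (d : nat) (e : rel V).
Context (mu : probability (Omega V) R) (P : spin -> spin -> R).
Hypothesis tree : is_cayley_tree d e.
Hypothesis markov : is_tree_markov_chain e mu.
Hypothesis invariant : is_automorphism_invariant e mu.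
Hypothesis transition : is_transition_matrix e mu P.
Hypothesis P_gt0 : forall x y, 0 < P x y.
Context (o : V) (par : V -> V) (dep : V -> nat).
Hypothesis rt : rooting e o par dep.

Local Notation mcyl := measurable_cylinder.

(** The path from [o] to [a] is mapped to a path from [phi o], each edge of which requires at most
    one more ancestor. *)
Lemma automorphism_descendants phi a : is_automorphism e phi ->
  descendants par (iter (dep a) par (phi o)) (phi a).
Proof.
move=> [_ edge_phi]; elim/(rooting_ind rt): a => [|a ao IH].
  by rewrite (dep_root rt); exact: descendants_refl.
rewrite (dep_par rt ao); apply: (descendants_edge rt _ IH).
by rewrite edge_phi (tree_sym tree) (edge_par rt).
Qed.

Lemma dep_bound (A : {fset V}) : exists n, forall k, k \in A -> (dep k <= n)%N.
Proof. by exists (\max_(k <- A) dep k)%N => k kA; exact: leq_bigmax_seq. Qed.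

Context (phi psi : nat -> V -> V).
Hypothesis phi_aut : forall m, is_automorphism e (phi m).
Hypothesis phiK : forall m, cancel (phi m) (psi m).
Hypothesis psiK : forall m, cancel (psi m) (phi m).
Hypothesis phi_dep : forall m, dep (phi m o) = m.

Lemma shifted_descendants (A : {fset V}) n m :
  (forall k, k \in A -> (dep k <= n)%N) ->
  [set` (phi m @` A)%fset] `<=` descendants par (iter n par (phi m o)).
Proof.
move=> An k /imfsetP[j /= jA ->].
apply: descendants_trans (automorphism_descendants j (phi_aut m)).
by exists (n - dep j)%N; rewrite -iterD subnK // An.
Qed.

Lemma markov_mixing (A B : {fset V}) z z' :
  (fun m => pr mu (cylinder A z `&` [set w : Omega V | cylinder B z' (w \o phi m)]))
    @ \oo --> pr mu (cylinder A z) * pr mu (cylinder B z').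
Proof.
have [n hn] := dep_bound (A `|` B)%fset.
have An k : k \in A -> (dep k <= n)%N by move=> kA; apply: hn; rewrite inE kA.
have Bn k : k \in B -> (dep k <= n)%N by move=> kB; apply: hn; rewrite inE kB orbT.
have [delta delta01 le_P] := transition_lower_bound tree transition P_gt0 rt.
(* After this shift [o] is moved to depth [m + 2n]. Its [n]-th ancestor there has depth [n + m], so
   [m] generations separate it from level [n], and the moved [B] lies behind it. *)
rewrite -(cvg_shiftn (n + n)%N).
apply: (@geometric_cvg _ (1 - delta) 2) => [|m].
  by rewrite ger0_norm; case/andP: delta01 => *; lra.
rewrite /=; set p := phi (m + (n + n))%N.
have -> : pr mu (cylinder B z') = pr mu [set w : Omega V | cylinder B z' (w \o p)].
  by rewrite /pr -(invariant (phi_aut (m + (n + n))%N)) //; exact: mcyl.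
rewrite (cylinder_comp (@phiK (m + (n + n))%N)).
apply: (chain_mixing tree markov transition P_gt0 rt (r := iter n par (p o)) (n := n)) => //.
- exact: F_cylinder.
- rewrite (iter_par_dep rt) phi_dep; last by rewrite addnA leq_addl.
  by rewrite addnA addnK addnC.
- exact: shifted_descendants.
Qed.

(** * From the starting measure to the time-evolved measure *)

Context (t : R) (mut : probability (Omega V) R) (K : R.-pker Omega V ~> Omega V).
Hypothesis flipK : is_spin_flip_kernel t K.
Hypothesis evolved : forall B, measurable B -> (mut B = \int[mu]_w K w B)%E.

(** The kernel value [K w (cylinder A z)], as an explicit function of finitely many spins of [w]. *)
Definition flip_weight (A : {fset V}) (z w : Omega V) : R :=
  \prod_(i <- A) flip_prob t (w i) (z i).

Lemma flip_weight_agree A z w w' : agree [set` A] w w' ->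
  flip_weight A z w = flip_weight A z w'.
Proof. by move=> ww'; apply: eq_big_seq => i iA; rewrite ww'. Qed.

Lemma flip_weight_shift (p q : V -> V) A B z z' w : cancel p q -> cancel q p ->
  (forall i, i \in A -> i \notin (p @` B)%fset) ->
  flip_weight (A `|` p @` B)%fset (splice A z (z' \o q)) w
  = flip_weight A z w * flip_weight B z' (w \o p).
Proof.
move=> pK qK disj; rewrite /flip_weight.
have -> : \prod_(i <- (A `|` p @` B)%fset) flip_prob t (w i) (splice A z (z' \o q) i)
    = \prod_(i <- (A : seq V) ++ (p @` B)%fset) flip_prob t (w i) (splice A z (z' \o q) i).
  apply: perm_big; apply: uniq_perm => //; last by move=> i; rewrite mem_cat inE.
  rewrite cat_uniq !fset_uniq andbT /=; apply/hasPn => i iB.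
  by apply/negP => /disj; rewrite iB.
rewrite big_cat; congr (_ * _).
  by apply: eq_big_seq => i iA; rewrite /splice iA.
rewrite big_imfset /=; last by move=> x y _ _; exact: can_inj pK _ _.
apply: eq_big_seq => i iB; rewrite /splice ifF /= ?pK //.
by apply/negP => /disj; rewrite in_imfset.
Qed.

(** Flips at distinct sites are independent, so the weight factorises over [A] and the image of [B].
    The coefficients do not involve [p], which reduces mixing of [mut] to mixing of [mu]. *)
Lemma pr_evolved_joint (p q : V -> V) A B z z' : cancel p q -> cancel q p ->
  (forall i, i \in A -> i \notin (p @` B)%fset) ->
  pr mut (cylinder A z `&` [set w : Omega V | cylinder B z' (w \o p)])
  = \sum_(x : {ffun A -> spin} * {ffun B -> spin})
      flip_weight A z (extend x.1) * flip_weight B z' (extend x.2) *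
      pr mu (cylinder A (extend x.1) `&`
             [set w : Omega V | cylinder B (extend x.2) (w \o p)]).
Proof.
move=> pK qK disj; have mT := @measurableT _ (Omega V).
have mjoint y y' : measurable (cylinder A y `&` [set w : Omega V | cylinder B y' (w \o p)]).
  by rewrite (cylinder_comp pK); apply: measurableI; exact: mcyl.
apply: EFin_inj; rewrite -prE // evolved //.
under eq_bigr do rewrite -[X in pr mu X]setIT.
rewrite -integral_indic_sum //; apply: eq_integral => w _.
rewrite (cylinder_comp pK) cylinderI; last first.
  by move=> i /=; rewrite inE => /andP[/disj/negbTE ->].
rewrite flipK; congr EFin.
rewrite -/(flip_weight _ _ w) flip_weight_shift //.
rewrite (finite_dimensional_sum (@flip_weight_agree A z) w).
rewrite (finite_dimensional_sum (@flip_weight_agree B z') (w \o p)).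
rewrite big_distrlr /= pair_bigA /=; apply: eq_bigr => -[x y] _ /=.
rewrite mulrACA; congr (_ * _); by rewrite !indicE in_setI -mulnb natrM.
Qed.

Lemma pr_evolved A z : pr mut (cylinder A z) =
  \sum_(x : {ffun A -> spin})
    flip_weight A z (extend x) * pr mu (cylinder A (extend x)).
Proof.
apply: EFin_inj; rewrite -prE ?evolved //; try exact: mcyl.
under [in RHS]eq_bigr do rewrite -[cylinder _ _]setIT.
rewrite -integral_indic_sum //; last by move=> x; exact: mcyl.
apply: eq_integral => w _; rewrite flipK; congr EFin.
exact: (finite_dimensional_sum (@flip_weight_agree A z)).
Qed.

Lemma measurable_comp_fun (p q : V -> V) (B : set (Omega V)) : cancel p q ->
  measurable B -> measurable [set w : Omega V | B (w \o p)].
Proof.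
move=> pK; move: B; apply: cylinder_induction.
- exact: measurable0.
- by move=> A z; rewrite (cylinder_comp pK); exact: mcyl.
- by move=> B C _ _ _; exact: measurableD.
- by move=> F _ _ mF; apply: bigcup_measurable => n _; exact: mF.
Qed.

Lemma evolved_invariant (p q : V -> V) (B : set (Omega V)) :
  is_automorphism e p -> cancel p q -> cancel q p -> measurable B ->
  mut [set w : Omega V | B (w \o p)] = mut B.
Proof.
move=> p_aut pK qK; move: B.
have m_comp C := @measurable_comp_fun _ _ C pK.
apply: cylinder_induction.
- by congr (mut _); apply/seteqP; split.
- move=> A z; rewrite prE; last by apply: m_comp; exact: mcyl.
  rewrite [RHS]prE; last exact: mcyl.
  (* The cylinder case is the joint formula with an empty first set, on which there is just one
     pattern. *)
  congr EFin; rewrite -[X in pr _ X]setTI -(cylinder0 z) (pr_evolved_joint _ _ pK qK) //.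
  rewrite pr_evolved.
  have inv (y : {ffun A -> spin}) : pr mu [set w : Omega V | cylinder A (extend y) (w \o p)]
      = pr mu (cylinder A (extend y)).
    exact (congr1 fine (invariant p_aut (mcyl A (extend y)))).
  rewrite -(pair_bigA _ (fun (x : {ffun fset0 -> spin}) (y : {ffun A -> spin}) =>
    flip_weight fset0 z (extend x) * flip_weight A z (extend y) *
    pr mu (cylinder fset0 (extend x) `&`
      [set w : Omega V | cylinder A (extend y) (w \o p)]))) /=.
  under eq_bigr => x _ do under eq_bigr => y _ do
    rewrite cylinder0 setTI inv {1}/flip_weight big_seq_fset0 mul1r.
  by rewrite sumr_const card_ffun -cardfE cardfs0 expn0.
- move=> B C mB mC CB EB EC.
  have CB' : [set w : Omega V | C (w \o p)] `<=` [set w : Omega V | B (w \o p)].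
    by move=> w; exact: CB.
  rewrite [LHS](_ : _ = mut ([set w : Omega V | B (w \o p)] `\` [set w : Omega V | C (w \o p)])) //.
  have mB' := m_comp _ mB; have mC' := m_comp _ mC.
  rewrite [LHS]prE ?[RHS]prE; try exact: measurableD.
  by rewrite !pr_setD // /pr EB EC.
(* By continuity from below both sides are limits of the same sequence. *)
- move=> F mF ndF EF; have mU := bigcup_measurable (fun k (_ : setT k) => mF k).
  have h1 := nondecreasing_cvg_mu (mu := mut) mF mU ndF.
  have h2 := @nondecreasing_cvg_mu _ _ _ mut (fun n => [set w : Omega V | F n (w \o p)])
    (fun n => m_comp _ (mF n)) (m_comp _ mU).
  apply: (cvg_unique _ _ h1) => //.
  rewrite (_ : mut \o F = mut \o (fun n => [set w : Omega V | F n (w \o p)])).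
    apply: h2 => n m nm; apply/subsetPset => w /=.
    exact: (subsetPset _ _ (ndF _ _ nm)).
  by apply/funext => n /=; rewrite EF.
Qed.

Lemma evolved_cylinder_mixing A B z z' :
  (fun m => pr mut (cylinder A z `&` [set w : Omega V | cylinder B z' (w \o phi m)]))
    @ \oo --> pr mut (cylinder A z) * pr mut (cylinder B z').
Proof.
pose F m (x : {ffun A -> spin} * {ffun B -> spin}) :=
  flip_weight A z (extend x.1) * flip_weight B z' (extend x.2) *
  pr mu (cylinder A (extend x.1) `&`
         [set w : Omega V | cylinder B (extend x.2) (w \o phi m)]).
have [n hn] := dep_bound (A `|` B)%fset.
(* For [m > 2n] the moved sites of [B] have depth at least [m - n > n], hence avoid [A], and the
   joint formula holds. *)
have eqF : \forall m \near \oo, \sum_x F m x =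
    pr mut (cylinder A z `&` [set w : Omega V | cylinder B z' (w \o phi m)]).
  exists (n + n).+1 => // m /= nm; rewrite (pr_evolved_joint _ _ (phiK m) (psiK m)) //.
  move=> i iA; apply/negP => iB.
  have Bn k : k \in B -> (dep k <= n)%N by move=> kB; apply: hn; rewrite inE kB orbT.
  have /(descendants_dep rt) := @shifted_descendants B n m Bn i iB.
  rewrite (iter_par_dep rt) phi_dep; last by apply: leq_trans (ltnW nm); rewrite leq_addl.
  have iAn : (dep i <= n)%N by apply: hn; rewrite inE iA.
  by move=> h; have := leq_trans h iAn; rewrite leq_subLR leqNgt nm.
apply: cvg_trans (near_eq_cvg eqF) _.
rewrite !pr_evolved big_distrlr /= pair_bigA /=.
apply: cvg_big => [|x _]; first exact: add_continuous.
rewrite mulrACA; apply: cvgMl_tmp; exact: markov_mixing.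
Qed.

(** Two extensions from cylinders: first in [B] with [C] a cylinder, then in [C] with [B] arbitrary.
    In the second, domination by [pr mut] comes from the invariance of [mut]. *)
Lemma evolved_mixing (B C : set (Omega V)) : measurable B -> measurable C ->
  (fun m => pr mut (B `&` [set w : Omega V | C (w \o phi m)])) @ \oo
    --> pr mut B * pr mut C.
Proof.
have m_comp m D := @measurable_comp_fun _ _ D (phiK m).
have inv m (D : set (Omega V)) : measurable D ->
    pr mut [set w : Omega V | D (w \o phi m)] = pr mut D.
  by move=> mD; rewrite /pr (evolved_invariant (phi_aut m) (phiK m) (psiK m)).
have prI_le (D D' : set (Omega V)) : measurable D -> measurable D' ->
    pr mut (D `&` D') <= pr mut D.
  by move=> mD mD'; apply: le_pr (measurableI _ _ mD mD') mD _ => w [].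
have pr_setID (A D D' : set (Omega V)) : measurable A -> measurable D ->
    measurable D' -> D' `<=` D ->
    pr mut (A `&` (D `\` D')) = pr mut (A `&` D) - pr mut (A `&` D').
  move=> mA mD mD' DD'; rewrite -pr_setD; try exact: measurableI.
    congr (pr mut _); apply/seteqP; split=> [w [Aw [Dw nD']]|w [[Aw Dw] nD']].
      by split=> // -[].
    by split=> //; split=> // D'w; apply: nD'.
  by move=> w [Aw /DD'].
have prM_le (D D' : set (Omega V)) : measurable D' ->
    0 <= pr mut D * pr mut D' <= pr mut D.
  by move=> mD'; rewrite mulr_ge0 ?pr_ge0 // ler_piMr ?pr_ge0 ?pr_le1.
have cyl_right A z : forall B, measurable B ->
    (fun m => pr mut (B `&` [set w : Omega V | cylinder A z (w \o phi m)])) @ \oo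
      --> pr mut B * pr mut (cylinder A z).
  have mA := mcyl A z.
  apply: (@dominated_setfun_cvg _ _ mut
    (fun m B => pr mut (B `&` [set w : Omega V | cylinder A z (w \o phi m)]))
    (fun B => pr mut B * pr mut (cylinder A z))).
  - move=> m D D' mD mD' DD'; have mAm := m_comp m _ mA.
    by rewrite !(setIC _ [set w : Omega V | cylinder A z _]) pr_setID.
  - by move=> D D' mD mD' DD'; rewrite pr_setD // mulrBl.
  - by move=> m D mD; rewrite pr_ge0 prI_le //; exact: m_comp.
  - by move=> D mD; exact: prM_le.
  - by move=> A' z'; exact: evolved_cylinder_mixing.
move=> mB; move: C; apply: (@dominated_setfun_cvg _ _ mut
    (fun m C => pr mut (B `&` [set w : Omega V | C (w \o phi m)]))
    (fun C => pr mut B * pr mut C)).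
- by move=> m D D' mD mD' DD'; rewrite -pr_setID //; [exact: m_comp..|move=> w; exact: DD'].
- by move=> D D' mD mD' DD'; rewrite pr_setD // mulrBr.
- move=> m D mD; rewrite pr_ge0 -(inv m D mD) setIC prI_le //; exact: m_comp.
- by move=> D mD; rewrite mulrC; exact: prM_le.
- by move=> A z; exact: cyl_right.
Qed.

Lemma invariant_zero_one (B : set (Omega V)) : measurable B ->
  (forall m, [set w : Omega V | B (w \o phi m)] = B) ->
  mut B = 0%E \/ mut B = 1%E.
Proof.
move=> mB inv; have := evolved_mixing mB mB.
under eq_fun do rewrite inv setIid.
move=> /(cvg_unique _ (cvg_cst _)) => /(_ _) h.
have : pr mut B * (pr mut B - 1) = 0 by rewrite mulrBr mulr1 -h // subrr.
move=> /eqP; rewrite mulf_eq0 subr_eq0 => /orP[/eqP E|/eqP E]; [left|right].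
  by rewrite prE // E.
by rewrite prE // E.
Qed.

End Ergodicity.

Theorem theorem2p7 (R : realType) (V : choiceType) (d : nat) (e : rel V)
    (mu : probability (Omega V) R) (P : spin -> spin -> R)
    (t : R) (mut : probability (Omega V) R)
    (tree : is_cayley_tree d e)
    (markov : is_tree_markov_chain e mu)
    (invariant : is_automorphism_invariant e mu)
    (transition : is_transition_matrix e mu P)
    (P_gt0 : forall x y, 0 < P x y)
    (t_ge0 : 0 <= t)
    (evolved : is_time_evolved t mu mut) :
  measurable (bad_configurations mut) /\
  (mut (bad_configurations mut) = 0%E \/ mut (bad_configurations mut) = 1%E).
Proof.
have [V0|/set0P[v _]] := eqVneq [set: V] set0.
  by case: (tree_infinite tree); rewrite V0.
have [par [dep rt]] := ex_rooting tree v.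
have mbad := measurable_bad mut (vertices_countable tree rt).
split=> //; case: evolved => K flipK mutE.
have ex_shift m : exists pq : (V -> V) * (V -> V), [/\ is_automorphism e pq.1,
    cancel pq.1 pq.2, cancel pq.2 pq.1 & dep (pq.1 v) = m].
  have [x xm] := ex_dep tree rt m.
  have [p p_aut px] := automorphism_transitive tree v x.
  by have [[q pK qK] _] := p_aut; exists (p, q); split=> //=; rewrite px.
have [pq hpq] := choice ex_shift.
apply: (invariant_zero_one tree markov invariant transition P_gt0 rt
  (phi := fun m => (pq m).1) (psi := fun m => (pq m).2) _ _ _ _ flipK mutE mbad);
  try by move=> m; case: (hpq m).
move=> m; have [p_aut pK qK _] := hpq m; set p := (pq m).1 in p_aut pK qK *.
set q := (pq m).2 in pK qK.
have q_aut : is_automorphism e q.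
  by split=> [|i j]; [exists p|rewrite -(p_aut.2) !qK].
(* One inclusion transports badness by [p], the other by the inverse automorphism [q]. *)
apply/seteqP; split=> [w|w bad_w].
  apply: (bad_comp pK qK) => B mB.
  exact: (evolved_invariant invariant flipK mutE p_aut pK qK mB).
apply: (bad_comp qK pK) => [B mB|].
  exact: (evolved_invariant invariant flipK mutE q_aut qK pK mB).
rewrite (_ : (_ \o _) \o _ = w) //.
by apply/funext => i /=; rewrite qK.
Qed.
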